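(* Let $n\geq 2$ and let $G=Q_n^3$ be the 3-ary $n$-cube. Let $1\le k\le 3^n$ and write $k = 3^{k_1}+3^{k_2}+\cdots+3^{k_r}$ with integers $n\ge k_1\geq k_2\geq \cdots\geq k_r\ge 0$. Then \[I_G(k) = k_{1}3^{k_1}+(k_{2}+1)3^{k_2}+(k_{3}+2)3^{k_3}+\cdots+(k_{r}+(r-1))3^{k_r}.\]
   Context: The 3-ary $n$-cube $Q_n^3$ is the graph whose vertices are the $n$-tuples $(x_{n-1},\dots,x_0)$ with $x_i\in\{0,1,2\}$, two vertices being adjacent iff they differ in exactly one coordinate $j$ and there $x_j\equiv y_j\pm1 \pmod 3$; equivalently $Q_n^3$ is the Cartesian product of $n$ copies of the cycle $C_3$. For a graph $G$ and $1\le k\le |V(G)|$, $I_G(k)$ denotes the maximum, over all vertex subsets $A$ with $|A|=k$, of the number of edges of $G$ with both endpoints in $A$.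
   Formalization: The representation of k is taken to be its ternary expansion (each exponent occurs at most twice among k_1,…,k_r); without this the formula fails, e.g. 4=1+1+1+1 would give 6 edges while I_G(4)=4. Every k with 1≤k≤3^n is still covered. *)

(* Defs.v *)
From mathcomp Require Import all_boot all_order all_algebra.

Set Implicit Arguments.
Unset Strict Implicit.
Unset Printing Implicit Defensive.

(* A finite simple graph on T is given by its adjacency relation e : rel T,
   and an edge is a two-element vertex set. *)
Definition edges (T : finType) (e : rel T) : {set {set T}} :=
  [set [set p.1; p.2] | p : T * T & e p.1 p.2].

Definition edges_within (T : finType) (e : rel T) (A : {set T}) :
    {set {set T}} :=
  [set E in edges e | E \subset A].

(* The maximum is over a nonempty family as soon as k <= #|T|. *)
Definition max_edges (T : finType) (e : rel T) (k : nat) : nat :=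
  \max_(A : {set T} | #|A| == k) #|edges_within e A|.

Definition cube3 (n : nat) := {ffun 'I_n -> 'I_3}.

(* The additions below are those of the ring 'I_3, that is, modulo 3. *)
Definition cube3_adj (n : nat) : rel (cube3 n) := fun x y =>
  [exists j : 'I_n,
     [forall i : 'I_n, (x i != y i) == (i == j)]
     && ((x j == y j + 1)%R || (x j == y j - 1)%R)].

Lemma cube3_adj_irr (n : nat) : irreflexive (@cube3_adj n).
Proof.
by move=> x; apply/existsP => -[j /andP[/forallP/(_ j)]]; rewrite !eqxx.
Qed.

Lemma cube3_adj_sym (n : nat) : symmetric (@cube3_adj n).
Proof.
move=> x y; apply: eq_existsb => j; congr andb.
  by apply: eq_forallb => i; rewrite [x i == _]eq_sym.
by case: (x j) (y j) => [[|[|[|?]]] ?] [[|[|[|?]]] ?].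
Qed.

(* Main.v *)
Require Import Defs.
From mathcomp Require Import all_boot all_order all_algebra.
From mathcomp Require Import zify.

(* Let s m be the sum of the ternary digits of m and F k := sum_(m < k) s m; this
   is the number of edges spanned by the first k vertices in lexicographic
   order.  Sort the vertices of A by their first coordinate into sections of sizes
   a, b, c: by induction A spans at most
     F a + F b + F c + min(a,b) + min(a,c) + min(b,c)
   edges, which is at most F (a + b + c), with equality when a, b, c are as equal
   as possible and the sections are nested.  Finally, F increases by
   (p + s q) 3^p from 3^p q to 3^p (q + 1), and when q is the sum of the terms
   preceding 3^p divided by 3^p, s q is their number. *)

(** * Ternary digit sums and their partial sums *)

(** Since [m < 3 ^ m], the positions below [m] include every nonzero digit. *)
Definition digit_sum3 (m : nat) : nat := \sum_(i < m) (m %/ 3 ^ i) %% 3.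

Definition lex_edges (k : nat) : nat := \sum_(m < k) digit_sum3 m.

Lemma digit_sum3_widen (m N : nat) : m <= N ->
  \sum_(i < N) (m %/ 3 ^ i) %% 3 = digit_sum3 m.
Proof.
move=> le_mN.
rewrite /digit_sum3 -!(big_mkord xpredT (fun i => (m %/ 3 ^ i) %% 3)).
rewrite (big_cat_nat (leq0n _) le_mN) /= [X in _ + X]big_nat_cond [X in _ + X]big1 ?addn0 //.
move=> i /andP[/andP[le_mi _] _]; rewrite divn_small //.
exact: leq_ltn_trans le_mi (ltn_expl i _).
Qed.

Lemma digit_sum3_cons (q t : nat) : t < 3 ->
  digit_sum3 (3 * q + t) = digit_sum3 q + t.
Proof.
move=> lt_t3; rewrite -(@digit_sum3_widen (3 * q + t) (3 * q + t).+1) //.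
rewrite big_ord_recl expn0 divn1 -(@digit_sum3_widen q (3 * q + t)); last by lia.
rewrite addnC; congr (_ + _); last by lia.
apply: eq_bigr => i _; rewrite lift0 expnS divnMA; congr ((_ %/ _) %% _).
by lia.
Qed.

Lemma digit_sum3_expM (p q : nat) : digit_sum3 (3 ^ p * q) = digit_sum3 q.
Proof.
elim: p => [|p IHp]; first by rewrite mul1n.
by rewrite expnS -mulnA -[3 * _]addn0 digit_sum3_cons // IHp addn0.
Qed.

Lemma digit_sum3S (q : nat) : q %% 3 <= 1 ->
  digit_sum3 q.+1 = (digit_sum3 q).+1.
Proof.
move=> q_mod; have -> : q.+1 = 3 * (q %/ 3) + (q %% 3).+1 by lia.
rewrite {3}(divn_eq q 3) [_ * 3]mulnC !digit_sum3_cons //; lia.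
Qed.

Lemma lex_edges0 : lex_edges 0 = 0. Proof. exact: big_ord0. Qed.

Lemma lex_edgesS (k : nat) : lex_edges k.+1 = lex_edges k + digit_sum3 k.
Proof. exact: big_ord_recr. Qed.

Lemma lex_edges_mul3 (q : nat) : lex_edges (3 * q) = 3 * lex_edges q + 3 * q.
Proof.
elim: q => [|q IHq]; first by rewrite muln0 lex_edges0.
have -> : 3 * q.+1 = (3 * q).+3 by lia.
have dsE := @digit_sum3_cons q.
have := dsE 0 isT; have := dsE 1 isT; have := dsE 2 isT.
by rewrite !lex_edgesS IHq addn0 addn1 addn2; lia.
Qed.

(** This is the equality case of the bound for three sections: [t] of them have size [q.+1], the
    others size [q], and [3 * q + (t == 2)] is the sum of the pairwise minima. *)
Lemma lex_edges_cons (q t : nat) : t < 3 ->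
  lex_edges (3 * q + t) =
    (3 - t) * lex_edges q + t * lex_edges q.+1 + 3 * q + (t == 2).
Proof.
have dsE := @digit_sum3_cons q; have := dsE 0 isT; have := dsE 1 isT.
rewrite addn0 addn1; case: t => [|[|[|//]]] d1 d0 _.
- by rewrite addn0 lex_edges_mul3 /=; lia.
- by rewrite addn1 !lex_edgesS lex_edges_mul3; lia.
by rewrite addn2 !lex_edgesS lex_edges_mul3; lia.
Qed.

Lemma lex_edges_thirds (k : nat) :
  lex_edges k = lex_edges ((k + 2) %/ 3) + lex_edges ((k + 1) %/ 3)
    + lex_edges (k %/ 3) + (k + 1) %/ 3 + 2 * (k %/ 3).
Proof.
rewrite {1}(divn_eq k 3) [_ * 3]mulnC lex_edges_cons ?ltn_mod //.
set q := k %/ 3; have kE : k = 3 * q + k %% 3 by lia.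
have : k %% 3 < 3 by rewrite ltn_mod.
case: (k %% 3) kE => [|[|[|//]]] kE _.
- have -> : (k + 2) %/ 3 = q by lia.
  have -> : (k + 1) %/ 3 = q by lia.
  lia.
- have -> : (k + 2) %/ 3 = q.+1 by lia.
  have -> : (k + 1) %/ 3 = q by lia.
  lia.
have -> : (k + 2) %/ 3 = q.+1 by lia.
have -> : (k + 1) %/ 3 = q.+1 by lia.
lia.
Qed.

(** The numbers in the block share the leading digits of [q], and their [p] low digits take all
    values, each averaging 1. *)
Lemma lex_edges_triadic_block (p q : nat) :
  lex_edges (3 ^ p * q.+1) = lex_edges (3 ^ p * q) + (p + digit_sum3 q) * 3 ^ p.
Proof.
elim: p => [|p IHp]; first by rewrite !mul1n lex_edgesS; lia.
rewrite !expnS -!mulnA !lex_edges_mul3 IHp; nia.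
Qed.

(** * The inequality for three section sizes *)

(** Strong induction on the total: both sides are cut into thirds by [lex_edges_cons], the thirds
    are compared by the induction hypothesis, and a linear inequality remains. *)
Lemma lex_edges_superadditive (a b c : nat) :
  lex_edges a + lex_edges b + lex_edges c
    + (minn a b + minn a c + minn b c) <= lex_edges (a + b + c).
Proof.
have [n le_n] : exists n, a + b + c <= n by exists (a + b + c).
elim: n a b c le_n => [|n IHn] a b c le_n.
  have [-> [-> ->]] : a = 0 /\ b = 0 /\ c = 0 by lia.
  by rewrite lex_edges0.
wlog [le_cb le_ba] : a b c le_n / c <= b /\ b <= a.
  move=> W.
  have [ab|ab] := leqP a b; have [ac|ac] := leqP a c; have [bc|bc] := leqP b c.
  - by have := W c b a; rewrite (_ : c + b + a = a + b + c); lia.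
  - by have := W b c a; rewrite (_ : b + c + a = a + b + c); lia.
  - by have := W c b a; rewrite (_ : c + b + a = a + b + c); lia.
  - by have := W b a c; rewrite (_ : b + a + c = a + b + c); lia.
  - by have := W c a b; rewrite (_ : c + a + b = a + b + c); lia.
  - by have := W c a b; rewrite (_ : c + a + b = a + b + c); lia.
  - by have := W a c b; rewrite (_ : a + c + b = a + b + c); lia.
  - by have := W a b c; lia.
(* A column sum can reach a third of the total rounded up, which is smaller than the total only from
   2 on. *)
have [S2|S2] := leqP (a + b + c) 1.
  have [-> ->] : b = 0 /\ c = 0 by lia.
  by rewrite !lex_edges0 !minn0 !addn0.
have [x [al [aE al3]]] : exists x al, a = 3 * x + al /\ al < 3.
  by exists (a %/ 3), (a %% 3); lia.
have [y [be [bE be3]]] : exists x al, b = 3 * x + al /\ al < 3.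
  by exists (b %/ 3), (b %% 3); lia.
have [z [ga [cE ga3]]] : exists x al, c = 3 * x + al /\ al < 3.
  by exists (c %/ 3), (c %% 3); lia.
have le_yx : y <= x by lia.
have le_zy : z <= y by lia.
(* Each of a, b, c is a sum of three parts differing by at most 1.  The larger
   parts are placed cyclically in three columns, so that the column sums are
   again as equal as possible, and the induction hypothesis is applied to each
   column. *)
have [t tE] : exists t, t = x + y + z by exists (x + y + z).
(* The booleans mark the larger parts in a column; the condition says that the column sum is at most
   a third of the total, rounded up. With iterated successors, the sum reduces to [t], [t.+1] or
   [t.+2] in concrete cases, matching [FS]. *)
have col (u v w : bool) : 3 * (u + v + w) <= al + be + ga + 2 ->
    (if u then lex_edges x.+1 else lex_edges x)
    + (if v then lex_edges y.+1 else lex_edges y)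
    + (if w then lex_edges z.+1 else lex_edges z)
    + (minn (x + u) (y + v) + minn (x + u) (z + w) + minn (y + v) (z + w))
    <= lex_edges (iter ((u + v)%coq_nat + w)%coq_nat succn t).
  move=> le_col; have le_uvw : (x + u) + (y + v) + (z + w) <= n by lia.
  have := IHn _ _ _ le_uvw.
  have -> : (x + u) + (y + v) + (z + w) = iter ((u + v)%coq_nat + w)%coq_nat succn t.
    by case: u v w {le_col le_uvw} => [] [] [] /=; lia.
  by case: u v w {le_col le_uvw} => [] [] [] /=; rewrite ?addn0 ?addn1.
have SE : a + b + c = 3 * t + (al + be + ga) by lia.
(* Three remainders add up to at most 6, so the default [0] of [nth] is never reached. *)
have FS s : s <= 6 -> lex_edges (3 * t + s) = nth 0
    [:: 3 * lex_edges t + 3 * t;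
        2 * lex_edges t + lex_edges t.+1 + 3 * t;
        lex_edges t + 2 * lex_edges t.+1 + 3 * t + 1;
        3 * lex_edges t.+1 + 3 * t + 3;
        2 * lex_edges t.+1 + lex_edges t.+2 + 3 * t + 3;
        lex_edges t.+1 + 2 * lex_edges t.+2 + 3 * t + 4;
        3 * lex_edges t.+2 + 3 * t + 6] s.
  case: s => [|[|[|s]]]; try by rewrite lex_edges_cons //=; lia.
  have -> : 3 * t + s.+3 = 3 * t.+1 + s by lia.
  case: s => [|[|[|s]]]; try by rewrite lex_edges_cons //=; lia.
  have -> : 3 * t.+1 + s.+3 = 3 * t.+2 + s by lia.
  by case: s => [|//]; rewrite lex_edges_cons //=; lia.
rewrite SE FS; last by lia.
rewrite aE bE cE !lex_edges_cons //; clear IHn SE S2 le_n FS.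
case: al al3 aE col => [|[|[|//]]] _ aE; case: be be3 bE => [|[|[|//]]] _ bE;
  case: ga ga3 cE => [|[|[|//]]] _ cE col.
all: lazymatch type of aE with _ = _ + ?al =>
  lazymatch type of bE with _ = _ + ?be =>
  lazymatch type of cE with _ = _ + ?ga =>
  (* Tests whether column [i] is among the [len] cyclically consecutive columns from [off] on. As
     [off] is at most 4, adding 6, a multiple of 3, avoids truncated subtraction. Each row starts
     where the previous one stopped. *)
  let row off len i := eval vm_compute in ((i + 6 - off) %% 3 < len) in
  let add i :=
    let u := row 0 al i in let v := row al be i in
    let w := row (al + be) ga i in
    generalize (col u v w isT) in
  add 0; add 1; add 2 end end end.
all: clear col; rewrite /= ?addn0 ?addn1.
(* The larger-part marks can decide a minimum only when the quotients agree; if [y < x], then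
   [y.+1 <= x]. *)
all: have [e|e] : (y = x \/ y < x) by lia.
all: have [e'|e'] : (z = y \/ z < y) by lia.
all: rewrite ?e' ?e in tE *.
all: clear -tE e e'; lia.
Qed.

(** * Counting edges by ordered pairs *)

(** Ordered pairs give a double sum, which splits along sections more easily than a set of unordered
    edges. *)
Definition arcs {T : finType} (e : rel T) (A : {set T}) : nat :=
  \sum_(x in A) \sum_(y in A) e x y.

(** The fibre of [ends] over an edge consists of its two orderings: symmetry puts both in [D],
    irreflexivity makes them distinct. *)
Lemma arcs_double_edges (T : finType) (e : rel T) (A : {set T}) :
  symmetric e -> irreflexive e -> arcs e A = 2 * #|edges_within e A|.
Proof.
move=> eC eI; pose ends (p : T * T) := [set p.1; p.2].
pose D := [set p : T * T | [&& p.1 \in A, p.2 \in A & e p.1 p.2]].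
have -> : arcs e A = #|D|.
  rewrite /arcs pair_big_dep /= -sum1dep_card big_mkcond [RHS]big_mkcond /=.
  by apply: eq_bigr => -[x y] _ /=; case: (x \in A); case: (y \in A); case: (e x y).
have -> : edges_within e A = ends @: D.
  apply/setP => E; apply/setIdP/imsetP => [[/imsetP[[x y]]]|[[x y]]].
    rewrite inE /= => exy ->; rewrite subUset !sub1set => /andP[xA yA].
    by exists (x, y); rewrite // inE /= xA yA.
  rewrite inE /= => /and3P[xA yA exy] ->; split.
    by apply/imsetP; exists (x, y); rewrite // inE.
  by rewrite subUset !sub1set xA.
rewrite -sum1_card (partition_big_imset ends) /= mulnC -sum_nat_const.
apply: eq_bigr => E /imsetP[[x y]]; rewrite inE /= => /and3P[xA yA exy] ->.
have nxy : x != y by apply: contraTneq exy => ->; rewrite eI.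
rewrite sum1dep_card (_ : [set _ | _] = [set (x, y); (y, x)]).
  by rewrite cards2 xpair_eqE negb_and nxy.
apply/setP => -[u v]; rewrite !inE /= !xpair_eqE.
rewrite /ends /=; apply/idP/idP => [/andP[/and3P[_ _ euv] /eqP uvE]|].
  have : u \in [set x; y] by rewrite -uvE set21.
  have : v \in [set x; y] by rewrite -uvE set22.
  rewrite !inE => /orP[]/eqP vE /orP[]/eqP uE; move: euv; rewrite uE vE ?eI // eqxx.
    by rewrite eqxx orbT.
  by rewrite eqxx.
case/orP => /andP[/eqP-> /eqP->]; first by rewrite xA yA exy eqxx.
by rewrite xA yA eC exy setUC eqxx.
Qed.

(** * Sections of the cube along the first coordinate *)

Definition cube_cons {n : nat} (i : 'I_3) (x : cube3 n) : cube3 n.+1 :=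
  [ffun j => if unlift ord0 j is Some j' then x j' else i].

Definition cube_tail {n : nat} (z : cube3 n.+1) : cube3 n := [ffun j => z (lift ord0 j)].

Lemma cube_cons0 (n : nat) (i : 'I_3) (x : cube3 n) : cube_cons i x ord0 = i.
Proof. by rewrite ffunE unlift_none. Qed.

Lemma cube_consS (n : nat) (i : 'I_3) (x : cube3 n) (j : 'I_n) :
  cube_cons i x (lift ord0 j) = x j.
Proof. by rewrite ffunE liftK. Qed.

Lemma cube_consK (n : nat) (i : 'I_3) (x : cube3 n) : cube_tail (cube_cons i x) = x.
Proof. by apply/ffunP => j; rewrite ffunE cube_consS. Qed.

Lemma cube_tailK (n : nat) (z : cube3 n.+1) : cube_cons (z ord0) (cube_tail z) = z.
Proof.
apply/ffunP => j; case: (unliftP ord0 j) => [j' ->|->]; last by rewrite cube_cons0.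
by rewrite cube_consS ffunE.
Qed.

Lemma big_cube_cons (n : nat) (F : cube3 n.+1 -> nat) :
  \sum_z F z = \sum_(i < 3) \sum_x F (cube_cons i x).
Proof.
rewrite pair_big /= (reindex (fun p : 'I_3 * cube3 n => cube_cons p.1 p.2)) //=.
exists (fun z : cube3 n.+1 => (z ord0, cube_tail z)) => [[i x] _|z _] /=.
  by rewrite cube_cons0 cube_consK.
exact: cube_tailK.
Qed.

(** Any two distinct residues modulo 3 differ by 1 or -1, so every two distinct sections are joined
    by the perfect matching of equal tails. *)
Lemma cube3_adj_cons (n : nat) (i j : 'I_3) (x y : cube3 n) :
  cube3_adj (cube_cons i x) (cube_cons j y) =
    if i == j then cube3_adj x y else x == y.
Proof.
have lift0F (m : 'I_n) : (lift ord0 m == ord0) = false.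
  by rewrite eq_sym (negPf (neq_lift _ _)).
apply/existsP/idP => [[l /andP[/forallP difP adjl]]|].
  case: (unliftP ord0 l) difP adjl => [l' ->|->] difP adjl.
    have := difP ord0; rewrite !cube_cons0 (negPf (neq_lift _ _)) eqbF_neg negbK.
    move=> ->; apply/existsP; exists l'; move: adjl; rewrite !cube_consS => ->.
    rewrite andbT; apply/forallP => m; have := difP (lift ord0 m).
    by rewrite !cube_consS (inj_eq (@lift_inj _ _)).
  have := difP ord0; rewrite !cube_cons0 eqxx eqb_id => /negPf ->.
  apply/eqP/ffunP => m; have := difP (lift ord0 m).
  by rewrite !cube_consS lift0F eqbF_neg negbK => /eqP.
case: eqP => [<-|/eqP nij].
  case/existsP => l /andP[/forallP difP adjl]; exists (lift ord0 l).
  rewrite !cube_consS adjl andbT; apply/forallP => m.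
  case: (unliftP ord0 m) => [m' ->|->].
    by rewrite !cube_consS (inj_eq (@lift_inj _ _)) difP.
  by rewrite !cube_cons0 eqxx (negPf (neq_lift _ _)).
move/eqP => <-; exists ord0; apply/andP; split.
  apply/forallP => m; case: (unliftP ord0 m) => [m' ->|->].
    by rewrite !cube_consS eqxx lift0F.
  by rewrite !cube_cons0 nij eqxx.
by rewrite !cube_cons0; case: i j nij => [[|[|[|?]]] ?] [[|[|[|?]]] ?].
Qed.

Definition cube_section {n : nat} (A : {set cube3 n.+1}) (i : 'I_3) : {set cube3 n} :=
  [set x | cube_cons i x \in A].

Lemma card_cube_section (n : nat) (A : {set cube3 n.+1}) :
  #|A| = \sum_(i < 3) #|cube_section A i|.
Proof.
rewrite -sum1_card big_mkcond big_cube_cons; apply: eq_bigr => i _.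
by rewrite -sum1_card [RHS]big_mkcond; apply: eq_bigr => x _; rewrite inE.
Qed.

Lemma arcs_cube_section (n : nat) (A : {set cube3 n.+1}) :
  arcs (@cube3_adj n.+1) A = \sum_(i < 3) \sum_(j < 3)
    if i == j then arcs (@cube3_adj n) (cube_section A i)
    else #|cube_section A i :&: cube_section A j|.
Proof.
rewrite /arcs big_mkcond big_cube_cons; apply: eq_bigr => i _.
transitivity (\sum_x \sum_(j < 3) \sum_y
   if (x \in cube_section A i) && (y \in cube_section A j) then
     (if i == j then cube3_adj x y else x == y) : nat else 0).
  apply: eq_bigr => x _; rewrite inE; case: (_ \in A) => /=; last first.
    by symmetry; apply: big1 => j _; apply: big1.
  rewrite big_mkcond big_cube_cons; apply: eq_bigr => j _.
  by apply: eq_bigr => y _; rewrite inE cube3_adj_cons.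
rewrite exchange_big /=; apply: eq_bigr => j _.
case: eqP => [<-|_].
  rewrite [RHS]big_mkcond; apply: eq_bigr => x _.
  case: (_ \in _) => /=; last by apply: big1.
  by rewrite [RHS]big_mkcond.
rewrite -sum1_card [RHS]big_mkcond; apply: eq_bigr => x _.
rewrite (bigD1 x) //= big1 ?addn0 => [|y nyx].
  by rewrite in_setI eqxx; case: ifP.
by rewrite eq_sym (negPf nyx); case: ifP.
Qed.

Local Notation o0 := (@Ordinal 3 0 isT).
Local Notation o1 := (@Ordinal 3 1 isT).
Local Notation o2 := (@Ordinal 3 2 isT).

Lemma sum_ord3 (F : 'I_3 -> nat) : \sum_(i < 3) F i = F o0 + F o1 + F o2.
Proof.
rewrite !big_ord_recl big_ord0 addn0 addnA.
by congr (F _ + F _ + F _); apply: val_inj.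
Qed.

Lemma arcs_cube_section3 (n : nat) (A : {set cube3 n.+1}) :
  let S := cube_section A in
  arcs (@cube3_adj n.+1) A =
    arcs (@cube3_adj n) (S o0) + arcs (@cube3_adj n) (S o1)
    + arcs (@cube3_adj n) (S o2)
    + 2 * (#|S o0 :&: S o1| + #|S o0 :&: S o2| + #|S o1 :&: S o2|).
Proof.
move=> S; rewrite arcs_cube_section !sum_ord3 /= -/S.
by rewrite (setIC (S o1) (S o0)) (setIC (S o2) (S o0)) (setIC (S o2) (S o1)); lia.
Qed.

Lemma arcs_cube0 (A : {set cube3 0}) : arcs (@cube3_adj 0) A = 0.
Proof.
apply: big1 => x _; apply: big1 => y _.
by rewrite /cube3_adj; case: existsP => // -[[]].
Qed.

(** * The upper bound and nested sets attaining it *)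

Lemma arcs_cube_le (n : nat) (A : {set cube3 n}) :
  arcs (@cube3_adj n) A <= 2 * lex_edges #|A|.
Proof.
elim: n A => [|n IHn] A; first by rewrite arcs_cube0.
rewrite arcs_cube_section3 card_cube_section sum_ord3.
set S := cube_section A.
have capE i j : #|S i :&: S j| <= minn #|S i| #|S j|.
  by rewrite leq_min !subset_leq_card ?subsetIl ?subsetIr.
have := lex_edges_superadditive #|S o0| #|S o1| #|S o2|.
have := capE o0 o1; have := capE o0 o2; have := capE o1 o2.
have := IHn (S o0); have := IHn (S o1); have := IHn (S o2).
lia.
Qed.

(** Nestedness is carried through the induction because it makes the common part of two sections as
    large as the smaller one. *)
Lemma lex_chain (n : nat) : exists c : nat -> {set cube3 n},
  [/\ forall k l, k <= l -> c k \subset c l,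
      forall k, k <= 3 ^ n -> #|c k| = k
    & forall k, k <= 3 ^ n -> arcs (@cube3_adj n) (c k) = 2 * lex_edges k].
Proof.
elim: n => [|n [c [c_sub c_card c_arcs]]].
  exists (fun k => if k is 0 then set0 else setT); split.
  - by case=> [|k] [|l] //; rewrite ?sub0set.
  - case=> [|[|//]] _; first by rewrite cards0.
    by rewrite cardsT card_ffun !card_ord.
  case=> [|[|//]] _; rewrite arcs_cube0 ?lex_edgesS lex_edges0 //.
  by rewrite /digit_sum3 big_ord0.
(* Vertices are added to sections 0, 1, 2 in turn, the first coordinate being the least significant
   digit. Section [i] then receives [(k + 2 - i) %/ 3] of the first [k], the sizes in
   [lex_edges_thirds]. *)
pose c' k := [set z : cube3 n.+1 | cube_tail z \in c ((k + (2 - z ord0)) %/ 3)].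
have c'E k (i : 'I_3) : cube_section (c' k) i = c ((k + (2 - i)) %/ 3).
  by apply/setP => x; rewrite !inE cube_consK cube_cons0.
exists c'; split=> [k l le_kl|k|k].
- apply/subsetP => z; rewrite !inE; apply/subsetP/c_sub.
  by apply: leq_div2r; rewrite leq_add2r.
- rewrite expnS => le_k; rewrite card_cube_section sum_ord3 !c'E /=.
  by rewrite !c_card; lia.
rewrite expnS => le_k; rewrite arcs_cube_section3 !c'E /=.
rewrite subn0 subnn addn0 (_ : 2 - 1 = 1) //.
have capE a b : b <= a -> a <= 3 ^ n -> #|c a :&: c b| = b.
  by move=> le_ba le_a; rewrite (setIidPr (c_sub _ _ le_ba)) c_card // (leq_trans le_ba).
rewrite !capE ?c_arcs; try lia.
rewrite (lex_edges_thirds k); lia.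
Qed.

(** * Evaluation at a sum of powers of 3 *)

(** The digit sum is carried along because the increment for the last, smallest power involves the
    digit sum of the preceding quotient. *)
Lemma lex_edges_ternary (r : nat) (ks : 'I_r -> nat) :
  (forall i j : 'I_r, i <= j -> ks j <= ks i) ->
  (forall a, \sum_(i < r) (ks i == a) <= 2) ->
  digit_sum3 (\sum_(i < r) 3 ^ ks i) = r /\
  lex_edges (\sum_(i < r) 3 ^ ks i) = \sum_(i < r) (ks i + i) * 3 ^ ks i.
Proof.
elim: r ks => [|r IHr] ks ks_mono ks_tern.
  by rewrite !big_ord0 /digit_sum3 big_ord0 lex_edges0.
pose w := widen_ord (leqnSn r); set p := ks ord_max.
have [||dsE lexE] := IHr (fun i => ks (w i)).
- by move=> i j le_ij; apply: ks_mono.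
- by move=> a; have := ks_tern a; rewrite big_ord_recr /=; apply/leq_trans/leq_addr.
have p_le i : p <= ks (w i) by apply: ks_mono; apply: ltnW (ltn_ord i).
set q := \sum_(i < r) 3 ^ (ks (w i) - p).
have qE : \sum_(i < r) 3 ^ ks (w i) = 3 ^ p * q.
  by rewrite big_distrr; apply: eq_bigr => i _ /=; rewrite -expnD subnKC.
(* Modulo 3 only exponents equal to [p] contribute to [q]. At most two exist and the last term is
   one of them, so adding it produces no carry. *)
have q_mod : q %% 3 <= 1.
  have -> : q = \sum_(i < r) (ks (w i) == p) +
      3 * \sum_(i < r | ks (w i) != p) 3 ^ (ks (w i) - p).-1.
    rewrite big_distrr [X in _ + X]big_mkcond -big_split; apply: eq_bigr => i _ /=.
    have := p_le i; case: eqP => [->|ne_p] le_p; first by rewrite subnn.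
    by rewrite -expnS prednK // subn_gt0; lia.
  have := ks_tern p; rewrite big_ord_recr /= eqxx addn1 ltnS.
  by rewrite [3 * _]mulnC [_ + _ * 3]addnC modnMDl; apply/leq_trans/leq_mod.
rewrite !big_ord_recr /= -/p qE -[X in _ + X]muln1 -mulnDr addn1.
rewrite digit_sum3_expM digit_sum3S // lex_edges_triadic_block.
by rewrite -(digit_sum3_expM p) -qE dsE lexE.
Qed.

Theorem theorem3p5 (n k r : nat) (ks : 'I_r -> nat)
    (hn : 2 <= n)
    (hk : 1 <= k <= 3 ^ n)
    (ks_le : forall i : 'I_r, ks i <= n)
    (ks_mono : forall i j : 'I_r, i <= j -> ks j <= ks i)
    (ks_ternary : forall a : nat, #|[set i : 'I_r | ks i == a]| <= 2)
    (k_eq : k = \sum_(i < r) 3 ^ ks i) :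
  max_edges (@cube3_adj n) k = \sum_(i < r) (ks i + i) * 3 ^ ks i.
Proof.
have [|_ <-] := lex_edges_ternary _ _ ks_mono.
  move=> a; rewrite -[\sum_(i < r) _]big_mkcond /= sum1dep_card; exact: ks_ternary.
rewrite -k_eq; case/andP: hk => _ le_k.
have edgesE := fun A => arcs_double_edges _ _ A (@cube3_adj_sym n) (@cube3_adj_irr n).
apply/eqP; rewrite eqn_leq; apply/andP; split.
  apply/bigmax_leqP => A /eqP cardA.
  by have := arcs_cube_le _ A; rewrite edgesE cardA leq_pmul2l.
have [c [_ c_card c_arcs]] := lex_chain n.
have := c_arcs _ le_k; rewrite edgesE => /eqP; rewrite eqn_pmul2l // => /eqP <-.
by apply: leq_bigmax_cond; rewrite c_card.
Qed.
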